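(* (1) (Adaptive composition) Let $M_1(w,D)$ satisfy $\epsilon_1$-HDP and let $M_2(W,D)|W$ satisfy $\epsilon_2$-HDP (that is, for each given input $W=v$ the mechanism $D\mapsto M_2(v,D)$ satisfies $\epsilon_2$-HDP). Then the composition $M^{(2)}(w,D)=(M_1(w,D),M_2(M_1(w,D),D))$ satisfies $(\epsilon_1+\epsilon_2-\frac12\epsilon_1\epsilon_2)$-HDP. (2) (Sequential composition) Let $M_1(w,D)$ satisfy $\epsilon_1$-HDP and $M_2(w,D)$ satisfy $\epsilon_2$-HDP. Then the composition $M^{(2)}(w,D)=(M_1(w,D),M_2(w,D))$ satisfies $(\epsilon_1+\epsilon_2-\frac12\epsilon_1\epsilon_2)$-HDP. (3) (Parallel composition) Let $M_1$ and $M_2$ satisfy $\epsilon_1$-HDP and $\epsilon_2$-HDP on two disjoint datasets $D_1$ and $D_2$ with distinct queries $w_1$ and $w_2$ respectively. Then the parallel composition $M^{(2)}(w_1,w_2,D_1,D_2)=(M_1(w_1,D_1),M_2(w_2,D_2))$ satisfies $\max\{\epsilon_1,\epsilon_2\}$-HDP.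
   Context: Datasets are elements $D=(x_1,\dots,x_n)$ of a database $\mathcal{D}\subset\mathbb{R}^n$. The Hamming distance $\|D-D'\|_H$ is the number of indices $i$ with $x_i\ne x_i'$; $D,D'$ are adjacent if $\|D-D'\|_H=1$. A query is a measurable map $W:\mathcal{D}\to\mathbb{R}^m$, $w=W(D)$. A mechanism $M$ is a randomized algorithm: for each dataset $D$ (and input $w$, which is either the query evaluated at that dataset or a given fixed vector) $M(w,D)$ is a random vector in $\mathbb{R}^m$ with a density with respect to Lebesgue measure. Distinct mechanisms use independent randomness; in adaptive composition the conditional law of the second component given $M_1(w,D)=v$ is the law of $M_2(v,D)$. $\epsilon$-HDP (Hellinger differential privacy), $\epsilon\in[0,2]$: for all adjacent $D,D'$, $D_{HD}(M(w,D),M(w,D'))\le\epsilon$, where for laws $P_1,P_2$ with densities $p_1,p_2$, $D_{HD}(P_1,P_2)=\int(\sqrt{p_1(x)}-\sqrt{p_2(x)})^2dx$. For parallel composition the data are pairs $(D_1,D_2)$ with $D_i\in\mathcal{D}_i$, $D_1\cap D_2=\emptyset$, and $(D_1,D_2)$, $(D_1',D_2')$ are adjacent if $\|D_1-D_1'\|_H+\|D_2-D_2'\|_H=1$. *)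

(* Defs.v *)
From HB Require Import structures.
From mathcomp Require Import all_boot all_order all_algebra.
From mathcomp Require Import all_classical all_reals all_analysis.
From mathcomp Require Import measurable_realfun.

Set Implicit Arguments.
Unset Strict Implicit.
Unset Printing Implicit Defensive.

Import Order.TTheory GRing.Theory Num.Theory.
Import numFieldNormedType.Exports.

Local Open Scope classical_set_scope.
Local Open Scope ring_scope.

Lemma sigma_finite_prod d1 d2 (T1 : measurableType d1) (T2 : measurableType d2)
    (R : realType) (m1 : {sigma_finite_measure set T1 -> \bar R})
    (m2 : {sigma_finite_measure set T2 -> \bar R}) :
  sigma_finite setT (m1 \x m2)%E.
Proof.
have /sigma_finiteP[F [TF ndF Foo]] := sigma_finiteT m1.
have /sigma_finiteP[G [TG ndG Goo]] := sigma_finiteT m2.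
exists (fun n => F n `*` G n) => [|k].
  apply/seteqP; split=> // -[x y] _.
  have [n _ Fnx] : (\bigcup_n F n) x by rewrite -TF.
  have [k _ Gky] : (\bigcup_n G n) y by rewrite -TG.
  exists (maxn n k) => //; split => /=.
  - by move: x Fnx; exact/subsetPset/ndF/leq_maxl.
  - by move: y Gky; exact/subsetPset/ndG/leq_maxr.
have [mF Fk] := Foo k; have [mG Gk] := Goo k; split; first exact: measurableX.
by rewrite product_measure1E// lte_mul_pinfty// ge0_fin_numE.
Qed.

Section lebesgue_tuple.
Context {R : realType}.

(* The library's Lebesgue measure lives on the copy measurableTypeR R of R;
   lebesgue1 is the same set function on R with its default display. *)
Definition lebesgue1 : set R -> \bar R := @lebesgue_measure R.

Let lebesgue1_additive : semi_sigma_additive lebesgue1.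
Proof. exact: (@measure_semi_sigma_additive _ (measurableTypeR R) _ (@lebesgue_measure R)). Qed.

HB.instance Definition _ := isMeasure.Build _ R R lebesgue1
  (measure0 (@lebesgue_measure R)) (measure_ge0 (@lebesgue_measure R)) lebesgue1_additive.

Let lebesgue1_sigma_finite : sigma_finite setT lebesgue1.
Proof. exact: (sigma_finiteT (@lebesgue_measure R)). Qed.

HB.instance Definition _ := Measure_isSigmaFinite.Build _ R R lebesgue1
  lebesgue1_sigma_finite.

Definition tcons (n : nat) (p : R * n.-tuple R) : n.+1.-tuple R :=
  [the n.+1.-tuple R of p.1 :: p.2].

Lemma measurable_tcons n : measurable_fun [set: R * n.-tuple R] (@tcons n).
Proof. exact: measurable_cons. Qed.

Section cons_measure.
Variables (n : nat) (mu : {sigma_finite_measure set (n.-tuple R) -> \bar R}).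

Definition cons_measure : set (n.+1.-tuple R) -> \bar R :=
  pushforward (lebesgue1 \x mu)%E (@tcons n).

Let cons_measure0 : cons_measure set0 = 0%E.
Proof. by rewrite /cons_measure /pushforward preimage_set0 measure0. Qed.

Let cons_measure_ge0 A : (0 <= cons_measure A)%E.
Proof. exact: (measure_ge0 (lebesgue1 \x mu)%E). Qed.

Let cons_measure_additive : semi_sigma_additive cons_measure.
Proof.
exact: (@measure_semi_sigma_additive _ _ _
  (measure_function_pushforward__canonical__measure_function_Measure
     (lebesgue1 \x mu)%E (@measurable_tcons n))).
Qed.

HB.instance Definition _ := isMeasure.Build _ (n.+1.-tuple R) R cons_measure
  cons_measure0 cons_measure_ge0 cons_measure_additive.

Definition tuncons (t : n.+1.-tuple R) : R * n.-tuple R :=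
  (thead t, [tuple of behead t]).

Lemma tconsK : cancel (@tcons n) tuncons.
Proof.
move=> [x t]; congr (_, _).
exact/val_inj.
Qed.

Lemma tunconsK : cancel tuncons (@tcons n).
Proof. by move=> t; rewrite [RHS]tuple_eta; exact/val_inj. Qed.

Lemma measurable_tuncons : measurable_fun setT tuncons.
Proof.
apply/measurable_fun_pairP; split => /=; first exact: measurable_tnth.
exact: measurable_behead.
Qed.

Let cons_measure_sigma_finite : sigma_finite setT cons_measure.
Proof.
have [F FT mF] := sigma_finite_prod lebesgue1 mu.
exists (fun k => tuncons @^-1` F k).
  by rewrite -preimage_bigcup -FT preimage_setT.
move=> k; have [mFk Fk] := mF k; split.
  by rewrite -[X in measurable X]setTI; exact: measurable_tuncons.
rewrite /cons_measure /pushforward (_ : _ @^-1` _ = F k)//.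
by apply/seteqP; split => x /=; rewrite tconsK.
Qed.

HB.instance Definition _ := Measure_isSigmaFinite.Build _ (n.+1.-tuple R) R
  cons_measure cons_measure_sigma_finite.

End cons_measure.

Fixpoint lebesgue (n : nat) : {sigma_finite_measure set (n.-tuple R) -> \bar R} :=
  match n with
  | 0 => dirac [tuple]
  | n'.+1 => cons_measure (lebesgue n')
  end.

(* Adequacy: lebesgue n assigns to a box the product of its side measures. *)
Lemma lebesgue_box n (A : 'I_n -> set R) : (forall i, measurable (A i)) ->
  lebesgue n [set t | forall i, A i (tnth t i)] =
  (\prod_(i < n) lebesgue_measure (A i))%E.
Proof.
elim: n A => [|n IH] A mA /=.
  by rewrite big_ord0 diracE mem_set//=; case.
rewrite /cons_measure /pushforward (_ : _ @^-1` _ =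
   A ord0 `*` [set t | forall i, A (lift ord0 i) (tnth t i)]); last first.
  apply/seteqP; split => -[x t] /=.
    move=> H; split; first by have := H ord0; rewrite (tnth_nth 0).
    by move=> i; have := H (lift ord0 i); rewrite /tcons/= tnthS.
  move=> [Ax At] i; have [j ->|->] := unliftP ord0 i.
    by rewrite tnthS; exact: At.
  by rewrite (tnth_nth 0).
rewrite product_measure1E//.
  by rewrite (IH (fun i => A (lift ord0 i)))// big_ord_recl.
rewrite (_ : mkset _ =
    \bigcap_(i in [set: 'I_n]) ((@tnth n R ^~ i) @^-1` A (lift ord0 i))).
  apply: fin_bigcap_measurable => // i _.
  by rewrite -[X in measurable X]setTI; exact: measurable_tnth.
by apply/seteqP; split => t /= H i; [move=> _|]; apply: H.
Qed.

End lebesgue_tuple.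
Arguments lebesgue : clear implicits.

Section hellinger.
Context {d : measure_display} {T : measurableType d} {R : realType}.
Implicit Types (mu P : set T -> \bar R) (p : T -> R).

Definition is_density mu P p : Prop :=
  [/\ measurable_fun setT p, forall x, 0 <= p x &
      forall A, measurable A -> (P A = \int[mu]_(x in A) (p x)%:E)%E].

Definition has_density mu P : Prop := exists p, is_density mu P p.

(* Some density of P (0 if there is none); two densities of a law agree
   mu-almost everywhere, so the choice is immaterial: see hellingerE. *)
Definition density mu P : T -> R := xget (cst 0) [set p | is_density mu P p].

Definition hellinger mu P1 P2 : \bar R :=
  (\int[mu]_x ((Num.sqrt (density mu P1 x) - Num.sqrt (density mu P2 x)) ^+ 2)%:E)%E.

(* P is the family of laws D |-> law of M(w, D); has_density is required
   explicitly because hellinger is meaningless without it. *)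
Definition HDP (X : Type) mu (DB : set X) (adj : X -> X -> Prop) (eps : R)
    (P : X -> set T -> \bar R) : Prop :=
  [/\ 0 <= eps <= 2,
      forall D, DB D -> has_density mu (P D) &
      forall D D', DB D -> DB D' -> adj D D' ->
        (hellinger mu (P D) (P D') <= eps%:E)%E].

End hellinger.

Lemma is_density_ae_eq d (T : measurableType d) (R : realType)
    (mu : {measure set T -> \bar R}) (P : set T -> \bar R) (p q : T -> R) :
  (P setT < +oo)%E -> is_density mu P p -> is_density mu P q -> ae_eq mu setT p q.
Proof.
move=> Poo [mp p0 pP] [mq q0 qP].
have : ae_eq mu setT (EFin \o p) (EFin \o q).
  apply: integral_ae_eq => //.
  - apply/integrableP; split; first exact/measurable_EFinP.
    under eq_integral do rewrite /= ger0_norm//.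
    by rewrite -pP.
  - exact/measurable_EFinP.
  - by move=> E _ mE; rewrite -pP// -qP.
by apply: filterS => x /= H /H [].
Qed.

Lemma hellingerE d (T : measurableType d) (R : realType)
    (mu : {measure set T -> \bar R}) (P1 P2 : set T -> \bar R) (p1 p2 : T -> R) :
  (P1 setT < +oo)%E -> (P2 setT < +oo)%E ->
  is_density mu P1 p1 -> is_density mu P2 p2 ->
  hellinger mu P1 P2 =
  (\int[mu]_x ((Num.sqrt (p1 x) - Num.sqrt (p2 x)) ^+ 2)%:E)%E.
Proof.
move=> P1oo P2oo dp1 dp2.
have dens P p : is_density mu P p ->
    is_density mu P (density mu P) by move=> ?; apply: (@xgetI _ (cst 0) _ p).
have msq (f g : T -> R) : measurable_fun setT f -> measurable_fun setT g ->
    measurable_fun setT (fun x => ((Num.sqrt (f x) - Num.sqrt (g x)) ^+ 2)%:E).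
  move=> mf mg; apply/measurable_EFinP; apply: measurable_funX.
  by apply: measurable_funB; apply: measurableT_comp => //;
    apply: continuous_measurable_fun; exact: sqrt_continuous.
have d1 := dens _ _ dp1; have d2 := dens _ _ dp2.
apply: ae_eq_integral => //.
- by apply: msq; [case: d1|case: d2].
- by apply: msq; [case: dp1|case: dp2].
have := is_density_ae_eq P2oo d2 dp2; have := is_density_ae_eq P1oo d1 dp1.
by apply: filterS2 => x /= /(_ I) -> /(_ I) ->.
Qed.

Section datasets.
Context {R : realType}.

Definition hamming (n : nat) (D D' : n.-tuple R) : nat :=
  #|[set i : 'I_n | tnth D i != tnth D' i]%SET|.

Definition hamming_adjacent (n : nat) (D D' : n.-tuple R) : Prop := hamming D D' = 1%N.

(* Measurability for the trace sigma-algebra on the (arbitrary) set DB. *)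
Definition query (n m : nat) (DB : set (n.-tuple R))
    (W : n.-tuple R -> m.-tuple R) : Prop :=
  forall B, measurable B ->
    exists2 A, measurable A & DB `&` W @^-1` B = DB `&` A.

(* A fixed input vector v is the constant query cst v. *)
Lemma query_cst (n m : nat) (DB : set (n.-tuple R)) (v : m.-tuple R) :
  query DB (cst v).
Proof.
move=> B _; have [Bv|Bv] := pselect (B v).
  by exists setT => //; congr (_ `&` _); apply/seteqP; split.
by exists set0 => //; congr (_ `&` _); apply/seteqP; split.
Qed.

Definition disjoint_data (n1 n2 : nat) (D1 : n1.-tuple R) (D2 : n2.-tuple R) : Prop :=
  forall i j, tnth D1 i != tnth D2 j.

Definition parallel_db (n1 n2 : nat) (DB1 : set (n1.-tuple R))
    (DB2 : set (n2.-tuple R)) : set (n1.-tuple R * n2.-tuple R) :=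
  [set D | [/\ DB1 D.1, DB2 D.2 & disjoint_data D.1 D.2]].

Definition parallel_adjacent (n1 n2 : nat) (D D' : n1.-tuple R * n2.-tuple R) : Prop :=
  (hamming D.1 D'.1 + hamming D.2 D'.2 = 1)%N.

End datasets.

(* M D v is the law of the output of M on the input vector v and dataset D;
   being a kernel in v is what makes M usable in adaptive composition. *)
Definition mechanism (R : realType) (n m : nat) : Type :=
  n.-tuple R -> R.-pker (m.-tuple R) ~> (m.-tuple R).

(* Outputs of compositions live in R^m1 * R^m2, whose Lebesgue measure is the
   product one. *)
Definition lebesgue2 (R : realType) (m1 m2 : nat) :
    set (m1.-tuple R * m2.-tuple R) -> \bar R :=
  (lebesgue R m1 \x lebesgue R m2)%E.

Section compositions.
Context {R : realType}.

(* kproduct_snd k1 k2 w is the law of (V, V') where V has law k1 w and, given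
   V = v, V' has law k2 v. *)
Definition adaptive_comp (n m : nat) (M1 M2 : mechanism R n m)
    (D : n.-tuple R) (w : m.-tuple R) : set (m.-tuple R * m.-tuple R) -> \bar R :=
  kproduct_snd (M1 D) (M2 D) w.

Definition sequential_comp (n m : nat) (M1 M2 : mechanism R n m)
    (D : n.-tuple R) (w : m.-tuple R) : set (m.-tuple R * m.-tuple R) -> \bar R :=
  (M1 D w \x M2 D w)%E.

Definition parallel_comp (n1 n2 m1 m2 : nat)
    (M1 : mechanism R n1 m1) (M2 : mechanism R n2 m2)
    (D : n1.-tuple R * n2.-tuple R) (w1 : m1.-tuple R) (w2 : m2.-tuple R) :
    set (m1.-tuple R * m2.-tuple R) -> \bar R :=
  (M1 D.1 w1 \x M2 D.2 w2)%E.

End compositions.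

(* Main.v *)
Require Import Defs.
From HB Require Import structures.
From mathcomp Require Import all_boot all_order all_algebra.
From mathcomp Require Import all_classical all_reals all_analysis.
From mathcomp Require Import measurable_realfun giry lra ring.

(* The Hellinger distance is 2 - 2 A with A the affinity, the integral of
   sqrt (p p'), and e1 + e2 - e1 e2 / 2 = 2 - 2 (1 - e1 / 2) (1 - e2 / 2): it
   suffices that affinities are supermultiplicative under composition.  The
   conditional densities of a kernel are not known to be jointly measurable, so
   the affinity of the joint laws Q, Q' is reached through the duality
     2 A(Q, Q') = inf over g > 0 of \int g dQ + \int 1/g dQ',
   (AM-GM, with equality at g = sqrt (r' / r) for positive densities r, r').
   The right-hand side disintegrates along the first coordinate v, and AM-GM in
   the second coordinate bounds the inner expression by 2 sqrt (p p') (v) times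
   the affinity of the two conditional laws at v.  Sequential composition is the
   case of kernels that ignore v; in parallel composition one of the two
   components is unchanged, i.e. has budget 0. *)

Set Implicit Arguments.
Unset Strict Implicit.
Unset Printing Implicit Defensive.

Import Order.TTheory GRing.Theory Num.Theory.
Import numFieldNormedType.Exports.

Local Open Scope classical_set_scope.
Local Open Scope ring_scope.

(** * Densities and absolute continuity *)

Section densities.
Context d (T : measurableType d) (R : realType).
Variables (mu : {sigma_finite_measure set T -> \bar R}).
Local Open Scope ereal_scope.

Lemma is_density_dominates (P : set T -> \bar R) (p : T -> R) :
  is_density mu P p -> P `<< mu.
Proof.
move=> [mp p0 PE]; apply/null_content_dominatesP => A mA muA0.
rewrite PE// (eq_integral (fun x => `|(p x)%:E|)); last first.
  by move=> x _; rewrite gee0_abs// lee_fin.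
by apply: integral_abs_eq0 => //; exact/measurable_funTS/measurable_EFinP.
Qed.

(** Radon-Nikodym; the derivative is finite everywhere, so [fine] makes it real-valued without
    changing its integrals. *)
Lemma dominates_has_density (P : {finite_measure set T -> \bar R}) :
  P `<< mu -> has_density mu P.
Proof.
move=> Pmu; pose f := Radon_Nikodym_SigmaFinite.f P mu.
have mf : measurable_fun setT f.
  exact/measurable_int/Radon_Nikodym_SigmaFinite.f_integrable.
exists (fine \o f); split.
- exact: measurableT_comp.
- by move=> x; exact/fine_ge0/Radon_Nikodym_SigmaFinite.f_ge0.
- move=> A mA; rewrite (Radon_Nikodym_SigmaFinite.f_integral Pmu)//.
  apply: eq_integral => x _.
  by rewrite /= fineK//; exact: Radon_Nikodym_SigmaFinite.f_fin_num.
Qed.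

(** Change of variables holds for the Radon-Nikodym derivative, and [p] agrees with it almost
    everywhere because both have the same integral over every measurable set. *)
Lemma ge0_integral_density (P : {finite_measure set T -> \bar R}) (p : T -> R)
    (f : T -> \bar R) : is_density mu P p ->
    measurable_fun setT f -> (forall x, 0 <= f x) ->
  \int[P]_x f x = \int[mu]_x ((p x)%:E * f x).
Proof.
move=> dp mf f0; have Pmu := is_density_dominates dp.
have [mp p0 PE] := dp.
have mRN : measurable_fun setT (Radon_Nikodym_SigmaFinite.f P mu).
  exact/measurable_int/Radon_Nikodym_SigmaFinite.f_integrable.
rewrite -(Radon_Nikodym_SigmaFinite.change_of_variables Pmu)//.
apply: ae_eq_integral => //.
- exact: emeasurable_funM.
- by apply: emeasurable_funM => //; exact/measurable_EFinP.
have : ae_eq mu setT (Radon_Nikodym_SigmaFinite.f P mu) (EFin \o p).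
  apply: integral_ae_eq => //.
  - exact: Radon_Nikodym_SigmaFinite.f_integrable.
  - exact/measurable_EFinP.
  - by move=> A _ mA; rewrite -PE// -Radon_Nikodym_SigmaFinite.f_integral.
by apply: filterS => x /= H /H ->; rewrite muleC.
Qed.

Lemma is_density_density (P : set T -> \bar R) :
  has_density mu P -> is_density mu P (density mu P).
Proof. by move=> [p dp]; exact: (@xgetI _ (cst 0%R) _ p). Qed.

Lemma hellinger_refl (P : set T -> \bar R) : hellinger mu P P = 0.
Proof. by apply: integral0_eq => x _; rewrite subrr expr0n. Qed.

End densities.

(** * Disintegration of a joint law along its first coordinate *)

Section disintegration.
Context d1 d2 (T1 : measurableType d1) (T2 : measurableType d2) (R : realType).
Local Open Scope ereal_scope.
Variables (P : probability T1 R) (K : T1 -> probability T2 R).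
Hypothesis mK : forall B, measurable B -> measurable_fun setT (fun v => K v B).
Variable Q : {measure set (T1 * T2) -> \bar R}.
Hypothesis QE : forall A, measurable A -> Q A = \int[P]_v K v (xsection A v).

(** The law of the pair [(v, y)] with [y] drawn from [K v]. In the Giry monad [Q] is the bind of [P]
    with [slice]. *)
Let slice (v : T1) : giry (T1 * T2)%type R :=
  giry_map (measurable_pair1 v) (K v : giry T2 R).

Let sliceE v A : slice v A = K v (xsection A v).
Proof. by rewrite xsectionE. Qed.

Let mKgiry : measurable_fun setT (K : T1 -> giry T2 R).
Proof. exact: measurable_giry_codensity. Qed.

Let slice_prod v A : measurable A ->
  slice v A = giry_prod (dirac v : giry T1 R, K v : giry T2 R) A.
Proof.
move=> mA; rewrite sliceE /giry_prod/= /product_subprobability/=.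
rewrite /product_measure1 integral_dirac// ?diracT ?mul1e//.
exact: measurable_fun_xsection.
Qed.

(** The slice at [v] is the product of the Dirac mass at [v] with [K v]; the Giry product, the unit
    and evaluation at [A] are all measurable maps. *)
Lemma measurable_kernel_xsection A : measurable A ->
  measurable_fun setT (fun v => K v (xsection A v)).
Proof.
move=> mA.
have mpair : measurable_fun setT
    (fun v => (giry_ret v : giry T1 R, K v : giry T2 R)).
  by apply/measurable_fun_pairP; split => //=; exact: measurable_giry_ret.
have := measurableT_comp (measurable_giry_ev (R := R) mA)
  (measurableT_comp (@measurable_giry_prod _ _ T1 T2 R) mpair).
congr measurable_fun; apply/funext => v.
by rewrite /= -sliceE slice_prod.
Qed.

Let mslice : measurable_fun setT slice.
Proof.
apply: measurable_giry_codensity => // A mA.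
under eq_fun do rewrite sliceE.
exact: measurable_kernel_xsection.
Qed.

Lemma measurable_kernel_integral (f : T1 * T2 -> \bar R) :
    measurable_fun setT f -> (forall z, 0 <= f z) ->
  measurable_fun setT (fun v => \int[K v]_y f (v, y)).
Proof.
move=> mf f0.
have -> : (fun v => \int[K v]_y f (v, y)) = giry_int ^~ f \o slice.
  by apply/funext => v; rewrite /= /slice giry_int_map.
exact: measurableT_comp (measurable_giry_int mf f0) mslice.
Qed.

(** Integration against a bind is iterated integration, and [Q] agrees with the bind of [P] and
    [slice] on measurable sets. *)
Lemma ge0_integral_disintegration (f : T1 * T2 -> \bar R) :
    measurable_fun setT f -> (forall z, 0 <= f z) ->
  \int[Q]_z f z = \int[P]_v \int[K v]_y f (v, y).
Proof.
move=> mf f0.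
have := giry_int_bind (P : giry T1 R) mslice mf f0.
rewrite {1 2}/giry_int.
under [X in _ = X -> _]eq_integral do rewrite giry_int_map//.
move=> <-; apply: eq_measure_integral => A mA _.
rewrite QE//= /giry_bind/= /giry_join/= [RHS]giry_int_map//.
  by apply: eq_integral => v _; rewrite /= -sliceE.
exact: measurable_giry_ev.
Qed.

End disintegration.

(** * Affinity and its relation to the Hellinger distance *)

Section affinity.
Context d (T : measurableType d) (R : realType).
Variables (mu : {sigma_finite_measure set T -> \bar R}).
Implicit Types P : probability T R.
Local Open Scope ereal_scope.

(** The Bhattacharyya coefficient. *)
Definition affinity (P P' : set T -> \bar R) : \bar R :=
  \int[mu]_x (Num.sqrt (density mu P x) * Num.sqrt (density mu P' x))%:E.

Lemma measurable_fun_sqrt (f : T -> R) :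
  measurable_fun setT f -> measurable_fun setT (fun x => Num.sqrt (f x)).
Proof.
move=> mf; apply: measurableT_comp => //.
by apply: continuous_measurable_fun; exact: sqrt_continuous.
Qed.

Lemma measurable_fun_inv (f : T -> R) : measurable_fun setT f ->
  (forall x, 0 <= f x)%R -> measurable_fun setT (fun x => (f x)^-1)%R.
Proof.
move=> mf f0; have -> : (fun x => (f x)^-1)%R = (@powR R ^~ (-1)%R) \o f.
  by apply/funext => x; rewrite /= powR_inv1.
exact: measurableT_comp.
Qed.

Lemma affinity_ge0 (P P' : set T -> \bar R) : 0 <= affinity P P'.
Proof. by apply: integral_ge0 => x _; rewrite lee_fin mulr_ge0 ?sqrtr_ge0. Qed.

(** Pointwise, the square plus twice the product of the roots is [p + p'], which integrates to 2.
    Writing this as a sum avoids subtracting extended reals before finiteness is known. *)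
Lemma hellinger_affinity P P' : has_density mu P -> has_density mu P' ->
  hellinger mu P P' + (affinity P P' + affinity P P') = 2%:E.
Proof.
move=> /is_density_density[mp p0 PE] /is_density_density[mp' p'0 P'E].
rewrite /hellinger /affinity.
set p := density mu P in mp p0 PE *; set p' := density mu P' in mp' p'0 P'E *.
have mA : measurable_fun setT (fun x => (Num.sqrt (p x) * Num.sqrt (p' x))%:E).
  by apply/measurable_EFinP; apply: measurable_funM; exact: measurable_fun_sqrt.
have mH : measurable_fun setT
    (fun x => ((Num.sqrt (p x) - Num.sqrt (p' x)) ^+ 2)%:E).
  apply/measurable_EFinP; apply: measurable_funX.
  by apply: measurable_funB; exact: measurable_fun_sqrt.
have A0 x : 0 <= (Num.sqrt (p x) * Num.sqrt (p' x))%:E.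
  by rewrite lee_fin mulr_ge0 ?sqrtr_ge0.
rewrite -ge0_integralD// -ge0_integralD//; last 3 first.
- by move=> x _; rewrite lee_fin sqr_ge0.
- by move=> x _; rewrite adde_ge0.
- exact: emeasurable_funD.
rewrite (eq_integral (fun x => (p x)%:E + (p' x)%:E)); last first.
  move=> x _; rewrite -!EFinD; congr EFin.
  rewrite -[in RHS](sqr_sqrtr (p0 x)) -[in RHS](sqr_sqrtr (p'0 x)); ring.
rewrite ge0_integralD//; [|by move=> x _; rewrite lee_fin|exact/measurable_EFinP
  |by move=> x _; rewrite lee_fin|exact/measurable_EFinP].
by rewrite -PE// -P'E// !probability_setT.
Qed.

(** Nonnegative terms summing to 2 are finite, so the comparison reduces to real arithmetic. *)
Lemma hellinger_le_affinity P P' (c : R) :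
    has_density mu P -> has_density mu P' ->
  (hellinger mu P P' <= (2 - 2 * c)%:E) = (c%:E <= affinity P P').
Proof.
move=> dP dP'; have := hellinger_affinity dP dP'.
have := affinity_ge0 P P'.
case: (affinity P P') => [A| |] //=; case: (hellinger mu P P') => [H| |] //= A0.
rewrite -!EFinD => -[HA]; rewrite !lee_fin.
by apply/idP/idP => ?; lra.
Qed.

End affinity.

(** * Pointwise inequalities behind the duality *)

Section weight.
Context {R : realType}.
Implicit Types r s a b g e : R.

(* sqrt (s / r) truncated where r or s vanishes, so that it stays positive. *)
Definition weight e r s : R :=
  if r == 0 then (if s == 0 then 1 else e^-1)
  else if s == 0 then e else Num.sqrt s / Num.sqrt r.

Lemma weight_gt0 e r s : 0 < e -> 0 <= r -> 0 <= s -> 0 < weight e r s.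
Proof.
move=> e0 r0 s0; rewrite /weight.
case: (eqVneq r 0) => [_|rn0]; case: (eqVneq s 0) => [_|sn0] //.
  by rewrite invr_gt0.
by rewrite divr_gt0// sqrtr_gt0 lt0r ?rn0 ?sn0.
Qed.

(** If [r] and [s] are both positive, the left side is exactly twice the product of the roots. If
    just one vanishes, the left side is [e] times the other, which the error term pays for. *)
Lemma weight_le e r s : 0 < e -> 0 <= r -> 0 <= s ->
  r * weight e r s + s * (weight e r s)^-1 <=
  2 * (Num.sqrt r * Num.sqrt s) + e * (r + s).
Proof.
move=> e0 r0 s0; rewrite /weight.
case: (eqVneq r 0) => [->|rn0]; case: (eqVneq s 0) => [->|sn0];
  rewrite ?sqrtr0 ?invrK ?mul0r ?mulr0 ?addr0 ?add0r ?mulr0//;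
  [by rewrite mulrC..|].
have rp : 0 < Num.sqrt r by rewrite sqrtr_gt0 lt0r rn0.
have sp : 0 < Num.sqrt s by rewrite sqrtr_gt0 lt0r sn0.
have : 0 <= e * (r + s) by rewrite mulr_ge0 ?addr_ge0// ltW.
rewrite -[in X in X * _ + _](sqr_sqrtr r0) -[in X in _ + X * _ <= _](sqr_sqrtr s0).
move: (e * _) rp sp => t; move: (Num.sqrt r) (Num.sqrt s) => x y x0 y0 t0.
have -> : x ^+ 2 * (y / x) + y ^+ 2 * (y / x)^-1 = 2 * (x * y).
  by field; rewrite !gt_eqF.
by rewrite lerDl.
Qed.

(** AM-GM: right minus left is the square of [sqrt (a r g) - sqrt (b s / g)]. *)
Lemma sqrt_weighted_le a b r s g : 0 <= a -> 0 <= b -> 0 <= r -> 0 <= s -> 0 < g ->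
  2 * (Num.sqrt a * Num.sqrt b * (Num.sqrt r * Num.sqrt s)) <=
  a * (r * g) + b * (s * g^-1).
Proof.
move=> a0 b0 r0 s0 g0.
have h0 : 0 < Num.sqrt g by rewrite sqrtr_gt0.
rewrite -[in leRHS](sqr_sqrtr a0) -[in leRHS](sqr_sqrtr b0).
rewrite -[in leRHS](sqr_sqrtr r0) -[in leRHS](sqr_sqrtr s0).
rewrite -[in leRHS](sqr_sqrtr (ltW g0)).
move: (Num.sqrt a) (Num.sqrt b) (Num.sqrt r) (Num.sqrt s) (Num.sqrt g) h0
  => {a0 b0 r0 s0 g0}x y z t h h0.
rewrite -subr_ge0.
have -> : x ^+ 2 * (z ^+ 2 * h ^+ 2) + y ^+ 2 * (t ^+ 2 * (h ^+ 2)^-1) -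
    2 * (x * y * (z * t)) = (x * z * h - y * t / h) ^+ 2.
  by field; rewrite gt_eqF.
exact: sqr_ge0.
Qed.

End weight.

(** * The two halves of the duality *)

Section testing.
Context d (T : measurableType d) (R : realType).
Variables (mu : {sigma_finite_measure set T -> \bar R}).
Implicit Types P : probability T R.
Local Open Scope ereal_scope.

(** Integrated AM-GM. The factors [a] and [b] will be the values at a point [v] of the densities of
    the first components, with [P] and [P'] the conditional laws at [v]. *)
Lemma affinity_le_test P P' (g : T -> R) (a b : R) :
    has_density mu P -> has_density mu P' ->
    measurable_fun setT g -> (forall x, 0 < g x)%R -> (0 <= a)%R -> (0 <= b)%R ->
  (2 * (Num.sqrt a * Num.sqrt b))%:E * affinity mu P P' <=
  a%:E * \int[P]_x (g x)%:E + b%:E * \int[P']_x (g x)^-1%:E.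
Proof.
move=> dP dP' mg g0 a0 b0.
have /is_density_density dp := dP; have /is_density_density dp' := dP'.
have mg' : measurable_fun setT (fun x => (g x)^-1)%R.
  by apply: measurable_fun_inv => // x; exact: ltW.
rewrite (ge0_integral_density dp)//; last 2 first.
- exact/measurable_EFinP.
- by move=> x; rewrite lee_fin ltW.
rewrite (ge0_integral_density dp')//; last 2 first.
- exact/measurable_EFinP.
- by move=> x; rewrite lee_fin invr_ge0 ltW.
rewrite /affinity.
move: dp dp'; set p := density mu P; set p' := density mu P'.
move=> [mp p0 _] [mp' p'0 _].
have mpg : measurable_fun setT (fun x => (p x)%:E * (g x)%:E).
  by apply/measurable_EFinP; exact: measurable_funM.
have mpg' : measurable_fun setT (fun x => (p' x)%:E * (g x)^-1%:E).
  by apply/measurable_EFinP; exact: measurable_funM.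
have pg0 x : 0 <= (p x)%:E * (g x)%:E by rewrite lee_fin mulr_ge0// ltW.
have pg'0 x : 0 <= (p' x)%:E * (g x)^-1%:E.
  by rewrite lee_fin mulr_ge0// invr_ge0 ltW.
have mA : measurable_fun setT (fun x => (Num.sqrt (p x) * Num.sqrt (p' x))%:E).
  by apply/measurable_EFinP; apply: measurable_funM; exact: measurable_fun_sqrt.
have A0 x : 0 <= (Num.sqrt (p x) * Num.sqrt (p' x))%:E.
  by rewrite lee_fin mulr_ge0 ?sqrtr_ge0.
rewrite -!ge0_integralZl//.
rewrite -ge0_integralD//; last 4 first.
- by move=> x _; rewrite mule_ge0// lee_fin.
- exact: measurable_funeM.
- by move=> x _; rewrite mule_ge0// lee_fin.
- exact: measurable_funeM.
apply: ge0_le_integral => //.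
- exact: measurable_funeM.
- by apply: emeasurable_funD; exact: measurable_funeM.
- by move=> x _; rewrite -!EFinM -EFinD lee_fin -mulrA sqrt_weighted_le.
Qed.

(** The infimum may fail to be attained where a density vanishes; the truncated [weight] comes
    within [2 * e] of it. *)
Lemma test_le_affinity P P' (e : R) :
    has_density mu P -> has_density mu P' -> (0 < e)%R ->
  exists g : T -> R, [/\ measurable_fun setT g, forall x, (0 < g x)%R &
    \int[P]_x (g x)%:E + \int[P']_x (g x)^-1%:E <=
    2%:E * affinity mu P P' + (2 * e)%:E].
Proof.
move=> dP dP' e0.
have /is_density_density dp := dP; have /is_density_density dp' := dP'.
have [mp p0 PE] := dp; have [mp' p'0 P'E] := dp'.
pose g x := weight e (density mu P x) (density mu P' x).
have mg : measurable_fun setT g.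
  rewrite /g /weight; apply: measurable_fun_ifT.
  - exact: measurable_fun_eqr.
  - by apply: measurable_fun_ifT => //; exact: measurable_fun_eqr.
  - apply: measurable_fun_ifT => //; first exact: measurable_fun_eqr.
    apply: measurable_funM; first exact: measurable_fun_sqrt.
    by apply: measurable_fun_inv => [|x]; [exact: measurable_fun_sqrt|exact: sqrtr_ge0].
have g0 x : (0 < g x)%R by exact: weight_gt0.
have g_le x : (density mu P x * g x + density mu P' x * (g x)^-1 <=
    2 * (Num.sqrt (density mu P x) * Num.sqrt (density mu P' x)) +
    e * (density mu P x + density mu P' x))%R by exact: weight_le.
 (* From here on only measurability, positivity and the pointwise bound of [g] matter, so its
    formula is forgotten. *)
 move: g mg g0 g_le => g mg g0 g_le.
exists g; split => //.
have mg' : measurable_fun setT (fun x => (g x)^-1)%R.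
  by apply: measurable_fun_inv => // x; exact: ltW.
rewrite (ge0_integral_density dp)//; last 2 first.
- exact/measurable_EFinP.
- by move=> x; rewrite lee_fin ltW.
rewrite (ge0_integral_density dp')//; last 2 first.
- exact/measurable_EFinP.
- by move=> x; rewrite lee_fin invr_ge0 ltW.
rewrite /affinity.
move: PE P'E mp mp' p0 p'0 g_le.
set p := density mu P; set p' := density mu P' => PE P'E mp mp' p0 p'0 g_le.
have mpg : measurable_fun setT (fun x => (p x)%:E * (g x)%:E).
  by apply/measurable_EFinP; exact: measurable_funM.
have mpg' : measurable_fun setT (fun x => (p' x)%:E * (g x)^-1%:E).
  by apply/measurable_EFinP; exact: measurable_funM.
have pg0 x : 0 <= (p x)%:E * (g x)%:E by rewrite lee_fin mulr_ge0// ltW.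
have pg'0 x : 0 <= (p' x)%:E * (g x)^-1%:E.
  by rewrite lee_fin mulr_ge0// invr_ge0 ltW.
have mA : measurable_fun setT (fun x => (Num.sqrt (p x) * Num.sqrt (p' x))%:E).
  by apply/measurable_EFinP; apply: measurable_funM; exact: measurable_fun_sqrt.
have A0 x : 0 <= (Num.sqrt (p x) * Num.sqrt (p' x))%:E.
  by rewrite lee_fin mulr_ge0 ?sqrtr_ge0.
have mpp : measurable_fun setT (fun x => (p x)%:E + (p' x)%:E).
  by apply: emeasurable_funD; exact/measurable_EFinP.
have pp0 x : 0 <= (p x)%:E + (p' x)%:E by rewrite lee_fin addr_ge0.
(* Both densities have mass 1, so the pointwise error [e * (p + p')] integrates to [2 * e]. *)
have -> : (2 * e)%:E = \int[mu]_x (e%:E * ((p x)%:E + (p' x)%:E)).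
  rewrite ge0_integralZl//; last by rewrite lee_fin ltW.
  rewrite ge0_integralD//; [|by move=> x _; rewrite lee_fin|exact/measurable_EFinP
    |by move=> x _; rewrite lee_fin|exact/measurable_EFinP].
  by rewrite -PE// -P'E// !probability_setT -EFinD -EFinM mulrC.
rewrite -ge0_integralZl// -!ge0_integralD//; last 3 first.
- exact: measurable_funeM.
- by move=> x _; rewrite mule_ge0// lee_fin ltW.
- exact: measurable_funeM.
apply: ge0_le_integral => //.
- by move=> x _; rewrite adde_ge0.
- exact: emeasurable_funD.
- by apply: emeasurable_funD; exact: measurable_funeM.
- by move=> x _; rewrite -!EFinM -!EFinD lee_fin.
Qed.

End testing.

(** * Measures of mass one as probabilities *)

Section measure_probability.
Context d (T : measurableType d) (R : realType).
Variables (Q : {measure set T -> \bar R}) (Q1 : Q setT = 1%E).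

(** The proof of mass one is an argument of the alias so that the probability structure can be
    attached to it. *)
Definition unit_mass & Q setT = 1%E : set T -> \bar R := Q.

HB.instance Definition _ := Measure.on (unit_mass Q1).
HB.instance Definition _ := Measure_isProbability.Build _ _ _ (unit_mass Q1) Q1.

Definition measure_probability : probability T R := unit_mass Q1.

End measure_probability.

(** * Composition bound for joint laws *)

Section joint_law.
Context d1 d2 (T1 : measurableType d1) (T2 : measurableType d2) (R : realType).
Variables (mu1 : {sigma_finite_measure set T1 -> \bar R})
          (mu2 : {sigma_finite_measure set T2 -> \bar R}).
Local Open Scope ereal_scope.

(* The sigma-finite structure of a product measure is not found by inference. *)
Definition prod_sigma_finite : {sigma_finite_measure set (T1 * T2)%type -> \bar R} :=
  HB.pack (mu1 \x mu2) (@Measure_isSigmaFinite.Build _ _ _ (mu1 \x mu2)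
    (sigma_finite_prod mu1 mu2)).

(** [Q] is the law of a pair whose first component has law [P] and whose second, given the value [v]
    of the first, has law [K v]. Since [K] is a bare function, its kernel measurability is a
    conjunct. *)
Definition joint_law (P : probability T1 R) (K : T1 -> probability T2 R)
    (Q : set (T1 * T2) -> \bar R) : Prop :=
  (forall B, measurable B -> measurable_fun setT (fun v => K v B)) /\
  (forall A, measurable A -> Q A = \int[P]_v K v (xsection A v)).

(** The product of the marginal and conditional densities might not be jointly measurable, so
    absolute continuity is shown instead and Radon-Nikodym supplies a density. *)
Lemma has_density_joint (P : probability T1 R) (K : T1 -> probability T2 R)
    (Q : probability (T1 * T2)%type R) :
    joint_law P K Q ->
    has_density mu1 P -> (forall v, has_density mu2 (K v)) ->
  has_density prod_sigma_finite Q.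
Proof.
move=> [mK QE] [p dp] dK; apply: dominates_has_density.
apply/null_content_dominatesP => A mA A0.
have mx := measurable_kernel_xsection mK mA.
have mx2 : measurable_fun setT (mu2 \o xsection A) by exact: measurable_fun_xsection.
rewrite [LHS]QE// (ge0_integral_density dp)//.
have [mp p0 PE] := dp.
rewrite -[RHS](integral0 mu1 setT); apply: ae_eq_integral => //.
  by apply: emeasurable_funM => //; exact/measurable_EFinP.
(* Almost every section of a product-null set is [mu2]-null, hence null for [K v]. *)
have : ae_eq mu1 setT (mu2 \o xsection A) (cst 0).
  apply/ae_eq_integral_abs => //.
  by rewrite -[RHS]A0; apply: eq_integral => v _; rewrite gee0_abs.
apply: filterS => v /= H /H xA0.
have [q dq] := dK v.
have /null_content_dominatesP -> := is_density_dominates dq => //.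
  by rewrite mule0.
exact: measurable_xsection.
Qed.

Variables (P P' : probability T1 R) (K K' : T1 -> probability T2 R).
Variables (Q Q' : probability (T1 * T2)%type R).
Hypotheses (QE : joint_law P K Q) (QE' : joint_law P' K' Q').
Hypotheses (dP : has_density mu1 P) (dP' : has_density mu1 P').
Hypotheses (dK : forall v, has_density mu2 (K v))
           (dK' : forall v, has_density mu2 (K' v)).

Lemma affinity_joint (c1 c2 : R) : (0 <= c2)%R ->
    c1%:E <= affinity mu1 P P' ->
    (forall v, c2%:E <= affinity mu2 (K v) (K' v)) ->
  (c1 * c2)%:E <= affinity prod_sigma_finite Q Q'.
Proof.
move=> c20 c1P c2K; apply/lee_addgt0Pr => e e0.
have dQ := has_density_joint QE dP dK.
have dQ' := has_density_joint QE' dP' dK'.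
have [g [mg g0 gle]] := test_le_affinity dQ dQ' e0.
(* The slack of [g] is [2 * e], so dividing by 2 leaves the required [e]. *)
suff : 2%:E * (c1 * c2)%:E <=
    \int[Q]_z (g z)%:E + \int[Q']_z (g z)^-1%:E.
  move=> /le_trans /(_ gle); rewrite (EFinM 2%R e) -muleDr// ?lee_pmul2l//.
  by rewrite ge0_adde_def ?inE ?lee_fin// ?affinity_ge0// ltW.
have mg' : measurable_fun setT (fun z => (g z)^-1%:E).
  by apply/measurable_EFinP/measurable_fun_inv => // z; exact: ltW.
have mge : measurable_fun setT (EFin \o g) by exact/measurable_EFinP.
have ge0 z : 0 <= (EFin \o g) z by rewrite lee_fin ltW.
have ge0' z : 0 <= (g z)^-1%:E by rewrite lee_fin invr_ge0 ltW.
rewrite (ge0_integral_disintegration QE.1 QE.2 mge)//.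
rewrite (ge0_integral_disintegration QE'.1 QE'.2 mg')//.
have mG := measurable_kernel_integral QE.1 mge ge0.
have mG' := measurable_kernel_integral QE'.1 mg' ge0'.
have /is_density_density dp := dP; have /is_density_density dp' := dP'.
rewrite (ge0_integral_density dp)//; last by move=> v; exact: integral_ge0.
rewrite (ge0_integral_density dp')//; last by move=> v; exact: integral_ge0.
have [mp p0 _] := dp; have [mp' p'0 _] := dp'.
have mpG : measurable_fun setT
    (fun v => (density mu1 P v)%:E * \int[K v]_y (EFin \o g) (v, y)).
  by apply: emeasurable_funM => //; exact/measurable_EFinP.
have mpG' : measurable_fun setT
    (fun v => (density mu1 P' v)%:E * \int[K' v]_y (g (v, y))^-1%:E).
  by apply: emeasurable_funM => //; exact/measurable_EFinP.
have G0 v : 0 <= (density mu1 P v)%:E * \int[K v]_y (EFin \o g) (v, y).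
  by rewrite mule_ge0 ?lee_fin// integral_ge0.
have G0' v : 0 <= (density mu1 P' v)%:E * \int[K' v]_y (g (v, y))^-1%:E.
  by rewrite mule_ge0 ?lee_fin// integral_ge0.
rewrite -ge0_integralD//.
(* Spend the bound on the first components now; what remains is an inequality of integrands in
   [v]. *)
apply: (@le_trans _ _ ((2 * c2)%:E * affinity mu1 P P')).
  rewrite -EFinM (_ : 2 * (c1 * c2) = 2 * c2 * c1)%R; last by ring.
  by rewrite EFinM lee_wpmul2l// lee_fin mulr_ge0.
have mA : measurable_fun setT
    (fun x => (Num.sqrt (density mu1 P x) * Num.sqrt (density mu1 P' x))%:E).
  by apply/measurable_EFinP; apply: measurable_funM; exact: measurable_fun_sqrt.
have A0 x : (0 <= Num.sqrt (density mu1 P x) * Num.sqrt (density mu1 P' x))%R.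
  by rewrite mulr_ge0 ?sqrtr_ge0.
rewrite /affinity -ge0_integralZl//; last by rewrite lee_fin mulr_ge0.
apply: ge0_le_integral => //.
- by move=> x _; rewrite lee_fin !mulr_ge0.
- exact: measurable_funeM.
- exact: emeasurable_funD.
(* At fixed [v] the section of [g] is a test for the two conditional laws, whose affinity is at
   least [c2]. *)
move=> v _; apply: le_trans; last first.
  apply: (@affinity_le_test _ _ _ mu2 (K v) (K' v) (fun y => g (v, y))) => //.
  exact: measurableT_comp.
rewrite -EFinM mulrAC EFinM; apply: lee_wpmul2l => //.
Qed.

(** Budgets become affinity bounds [c = 1 - e / 2], which multiply; [e2 <= 2] says that the second
    one is nonnegative. *)
Lemma hellinger_joint (e1 e2 : R) : (e2 <= 2)%R ->
    hellinger mu1 P P' <= e1%:E ->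
    (forall v, hellinger mu2 (K v) (K' v) <= e2%:E) ->
  hellinger prod_sigma_finite Q Q' <= (e1 + e2 - 2^-1 * e1 * e2)%:E.
Proof.
move=> e22 He1 He2.
have E (e : R) : e = (2 - 2 * (1 - e / 2))%R by lra.
rewrite (E e1) hellinger_le_affinity// in He1.
have {}He2 v : (1 - e2 / 2)%:E <= affinity mu2 (K v) (K' v).
  by move: (He2 v); rewrite {1}(E e2) hellinger_le_affinity.
have -> : (e1 + e2 - 2^-1 * e1 * e2)%R =
    (2 - 2 * ((1 - e1 / 2) * (1 - e2 / 2)))%R by lra.
rewrite hellinger_le_affinity; first by apply: affinity_joint => //; lra.
  exact: has_density_joint QE dP dK.
exact: has_density_joint QE' dP' dK'.
Qed.

End joint_law.

(** The budget is [e1 * (1 - e2 / 2) + e2], and 2 minus it is [(2 - e1) * (2 - e2) / 2]. *)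
Lemma composed_budget_itv (R : realFieldType) (e1 e2 : R) :
  0 <= e1 <= 2 -> 0 <= e2 <= 2 -> 0 <= e1 + e2 - 2^-1 * e1 * e2 <= 2.
Proof. by move=> /andP[? ?] /andP[? ?]; apply/andP; split; nra. Qed.

(** * Products and kernel compositions as joint laws *)

Section joint_laws_of_kernels.
Context d0 d1 d2 (T0 : measurableType d0) (T1 : measurableType d1)
  (T2 : measurableType d2) (R : realType).
Local Open Scope ereal_scope.

Definition kernel_law d d' (X : measurableType d) (Y : measurableType d')
    (k : R.-pker X ~> Y) (x : X) : probability Y R :=
  measure_probability (prob_kernel (s := k) x).

Lemma joint_law_prod (P1 : probability T1 R) (P2 : probability T2 R) :
  joint_law P1 (fun=> P2) (P1 \x P2).
Proof. by split. Qed.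

Lemma joint_law_kproduct (k1 : R.-pker T0 ~> T1) (k2 : R.-pker T1 ~> T2) w :
  joint_law (kernel_law k1 w) (kernel_law k2) (kproduct_snd k1 k2 w).
Proof.
split=> [B mB|A mA]; first exact: measurable_kernel.
by apply: eq_integral => v _; exact: (kernel.intker_indicE (kernel.kernel_snd k2)).
Qed.

Lemma kproduct_snd_setT (k1 : R.-pker T0 ~> T1) (k2 : R.-pker T1 ~> T2) w :
  kproduct_snd k1 k2 w setT = 1.
Proof.
rewrite (joint_law_kproduct k1 k2 w).2//.
rewrite (eq_integral (cst 1)) => [|v _]; last first.
  by rewrite xsectionE; exact: (probability_setT (kernel_law k2 v)).
by rewrite integral_cst// mul1e; exact: probability_setT.
Qed.

(** Bundles the law of the adaptive composition as a probability, the form in which the joint-law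
    bounds accept it. *)
Definition kproduct_law (k1 : R.-pker T0 ~> T1) (k2 : R.-pker T1 ~> T2) w :
    probability (T1 * T2)%type R :=
  @measure_probability _ _ _ (mkproduct k1 (kernel.kernel_snd k2) w)
    (kproduct_snd_setT k1 k2 w).

End joint_laws_of_kernels.

(** * The three composition theorems *)

Lemma hamming0_eq (R : realType) (n : nat) (D D' : n.-tuple R) :
  hamming D D' = 0%N -> D = D'.
Proof.
move=> /eqP; rewrite cards_eq0 => /eqP H; apply: eq_from_tnth => i.
have : i \notin [set j | tnth D j != tnth D' j]%SET by rewrite H inE.
by rewrite inE negbK => /eqP.
Qed.

Theorem theorem2p3 (R : realType) :
  (* adaptive composition *)
  (forall (n m : nat) (DB : set (n.-tuple R)) (w : n.-tuple R -> m.-tuple R)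
      (M1 M2 : mechanism R n m) (eps1 eps2 : R),
    query DB w ->
    HDP (lebesgue R m) DB (@hamming_adjacent R n) eps1 (fun D => M1 D (w D)) ->
    (forall v : m.-tuple R,
      HDP (lebesgue R m) DB (@hamming_adjacent R n) eps2 (fun D => M2 D v)) ->
    HDP (@lebesgue2 R m m) DB (@hamming_adjacent R n)
      (eps1 + eps2 - 2^-1 * eps1 * eps2)
      (fun D => adaptive_comp M1 M2 D (w D)))
  /\
  (* sequential composition *)
  (forall (n m : nat) (DB : set (n.-tuple R)) (w : n.-tuple R -> m.-tuple R)
      (M1 M2 : mechanism R n m) (eps1 eps2 : R),
    query DB w ->
    HDP (lebesgue R m) DB (@hamming_adjacent R n) eps1 (fun D => M1 D (w D)) ->
    HDP (lebesgue R m) DB (@hamming_adjacent R n) eps2 (fun D => M2 D (w D)) ->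
    HDP (@lebesgue2 R m m) DB (@hamming_adjacent R n)
      (eps1 + eps2 - 2^-1 * eps1 * eps2)
      (fun D => sequential_comp M1 M2 D (w D)))
  /\
  (* parallel composition *)
  (forall (n1 n2 m1 m2 : nat)
      (DB1 : set (n1.-tuple R)) (DB2 : set (n2.-tuple R))
      (w1 : n1.-tuple R -> m1.-tuple R) (w2 : n2.-tuple R -> m2.-tuple R)
      (M1 : mechanism R n1 m1) (M2 : mechanism R n2 m2) (eps1 eps2 : R),
    query DB1 w1 -> query DB2 w2 ->
    HDP (lebesgue R m1) DB1 (@hamming_adjacent R n1) eps1 (fun D => M1 D (w1 D)) ->
    HDP (lebesgue R m2) DB2 (@hamming_adjacent R n2) eps2 (fun D => M2 D (w2 D)) ->
    HDP (@lebesgue2 R m1 m2) (parallel_db DB1 DB2) (@parallel_adjacent R n1 n2)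
      (Num.max eps1 eps2)
      (fun D => parallel_comp M1 M2 D (w1 D.1) (w2 D.2))).
Proof.
split; [|split].
- move=> n m DB w M1 M2 eps1 eps2 _ [e1 dM1 hM1] hdpM2.
  (* The range of [eps2] is part of the hypothesis at each input [v]; the zero vector serves as one
     such input. *)
  have [e2 _ _] := hdpM2 (nseq_tuple m 0).
  have dM2 v D : DB D -> has_density (lebesgue R m) (M2 D v).
    by have [_ + _] := hdpM2 v; exact.
  have hM2 v D D' : DB D -> DB D' -> hamming_adjacent D D' ->
      (hellinger (lebesgue R m) (M2 D v) (M2 D' v) <= eps2%:E)%E.
    by have [_ _] := hdpM2 v; exact.
  split=> [|D DBD|D D' DBD DBD' DD']; first exact: composed_budget_itv.
    exact: (has_density_joint (Q := kproduct_law (M1 D) (M2 D) (w D))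
      (joint_law_kproduct (M1 D) (M2 D) (w D)) (dM1 _ DBD) (fun v => dM2 v _ DBD)).
  apply: (hellinger_joint (Q := kproduct_law (M1 D) (M2 D) (w D))
    (Q' := kproduct_law (M1 D') (M2 D') (w D'))
    (joint_law_kproduct (M1 D) (M2 D) (w D))
    (joint_law_kproduct (M1 D') (M2 D') (w D'))
    (dM1 _ DBD) (dM1 _ DBD') (fun v => dM2 v _ DBD) (fun v => dM2 v _ DBD')).
  + by case/andP: e2.
  + exact: hM1.
  + by move=> v; exact: hM2.
- move=> n m DB w M1 M2 eps1 eps2 _ [e1 dM1 hM1] [e2 dM2 hM2].
  pose P1 D := kernel_law (M1 D) (w D).
  pose P2 D := kernel_law (M2 D) (w D).
  split=> [|D DBD|D D' DBD DBD' DD']; first exact: composed_budget_itv.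
    exact: (has_density_joint (joint_law_prod (P1 D) (P2 D))
      (dM1 _ DBD) (fun=> dM2 _ DBD)).
  apply: (hellinger_joint (joint_law_prod (P1 D) (P2 D))
    (joint_law_prod (P1 D') (P2 D')) (dM1 _ DBD) (dM1 _ DBD')
    (fun=> dM2 _ DBD) (fun=> dM2 _ DBD')).
  + by case/andP: e2.
  + exact: hM1.
  + by move=> v; exact: hM2.
- move=> n1 n2 m1 m2 DB1 DB2 w1 w2 M1 M2 eps1 eps2 _ _.
  move=> [e1 dM1 hM1] [e2 dM2 hM2].
  pose P1 D := kernel_law (M1 D) (w1 D).
  pose P2 D := kernel_law (M2 D) (w2 D).
  have [/andP[e10 e12] /andP[e20 e22]] := (e1, e2).
  split=> [|[D1 D2] [/= DB1D DB2D _]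
    |[D1 D2] [D1' D2'] [/= DB1D DB2D _] [/= DB1D' DB2D' _]].
  + by rewrite le_max e10 ge_max e12 e22.
  + exact: (has_density_joint (joint_law_prod (P1 D1) (P2 D2))
      (dM1 _ DB1D) (fun=> dM2 _ DB2D)).
  (* The budgets [a] and [b] are left free so that the unchanged component can be given 0. *)
  have bound (a b : R) : b <= 2 ->
      (hellinger (lebesgue R m1) (P1 D1) (P1 D1') <= a%:E)%E ->
      (hellinger (lebesgue R m2) (P2 D2) (P2 D2') <= b%:E)%E ->
      (hellinger (@lebesgue2 R m1 m2) (P1 D1 \x P2 D2) (P1 D1' \x P2 D2') <=
        (a + b - 2^-1 * a * b)%:E)%E.
    move=> b2 ha hb.
    exact: (hellinger_joint (joint_law_prod (P1 D1) (P2 D2))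
      (joint_law_prod (P1 D1') (P2 D2')) (dM1 _ DB1D) (dM1 _ DB1D')
      (fun=> dM2 _ DB2D) (fun=> dM2 _ DB2D') b2 ha (fun=> hb)).
  rewrite /parallel_adjacent/=.
  (* The two distances sum to 1, so one of them is 0 and that component of the data is unchanged. *)
  case h1: (hamming D1 D1') => [|[|k]] // h2.
  + have eqD := hamming0_eq h1.
    apply: (le_trans (bound 0 eps2 e22 _ _)).
    * by rewrite eqD hellinger_refl.
    * exact: hM2.
    * by rewrite lee_fin mulr0 mul0r add0r subr0 le_max lexx orbT.
  + have eqD : D2 = D2' by apply: hamming0_eq; case: h2.
    apply: (le_trans (bound eps1 0 _ _ _)).
    * by [].
    * exact: hM1.
    * by rewrite eqD hellinger_refl.
    * by rewrite lee_fin mulr0 addr0 subr0 le_max lexx.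
Qed.
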